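(* Let $(G,+)$ be an Abelian group and let $H\subseteq G$ satisfy: $0\in H$; for all $x,y\in H$, $x-y\in H$ or $y-x\in H$; and for all $x,y,z\in H$, if $x-y\in H$ and $y-z\in H$ then $x-z\in H$. Let $f\colon H\to[0,\infty)$ be a bounded even function and let $\mathbf{E}_f$ be the relation on $H^{\omega}$ defined by $$(x_n)\,\mathbf{E}_f\,(y_n)\iff \sum_{n<\omega} f\big((y_n-x_n)^{+}\big)<\infty .$$ Then $\mathbf{E}_f$ is an equivalence relation if and only if the following two conditions hold: (R1) $f(0)=0$; (R2) there is a constant $C\ge 1$ such that for all $x,y\in H$ with $x+y\in H$, (a) $f(x+y)\le C\,(f(x)+f(y))$ and (b) $f(x)\le C\,(f(x+y)+f(y))$.
   Context: For $x\in H\cup(-H)$, $x^{+}$ denotes $x$ if $x\in H$, and $-x$ if $x\in(-H)\setminus H$. (By the second condition on $H$, $y-x\in H\cup(-H)$ for all $x,y\in H$, so $\mathbf{E}_f$ is well defined.) A function $f\colon H\to[0,\infty)$ is called even if $f(x)=f(-x)$ for every $x\in H\cap(-H)$. *)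

(* Defs.v *)
From mathcomp Require Import all_boot all_order all_algebra.
From mathcomp Require Import all_classical all_reals all_analysis.
From Stdlib Require Export RelationClasses.

Set Implicit Arguments.
Unset Strict Implicit.
Unset Printing Implicit Defensive.

Import Order.TTheory GRing.Theory Num.Theory.

Local Open Scope classical_set_scope.
Local Open Scope ring_scope.

(* x^+, meant for x in H `|` -H; the value elsewhere is junk. *)
Definition pos_of (G : zmodType) (H : set G) (x : G) : G :=
  if x \in H then x else - x.

(* A function f : H -> [0, oo[ is represented by a total f : G -> R of which
   only the restriction to H matters; set_type H is H viewed as a type, so
   nat -> set_type H is H^omega. *)
Definition nonneg_on (G : zmodType) (R : realType) (H : set G) (f : G -> R)
    : Prop :=
  forall x, H x -> 0 <= f x.

Definition bounded_on (G : zmodType) (R : realType) (H : set G) (f : G -> R)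
    : Prop :=
  exists M : R, forall x, H x -> f x <= M.

Definition even_on (G : zmodType) (R : realType) (H : set G) (f : G -> R)
    : Prop :=
  forall x, H x -> H (- x) -> f x = f (- x).

Definition Ef (G : zmodType) (R : realType) (H : set G) (f : G -> R)
    (x y : nat -> set_type H) : Prop :=
  (\sum_(0 <= n <oo) (f (pos_of H (set_val (y n) - set_val (x n))))%:E
     < +oo)%E.

(* Main.v *)
Require Import Defs.
From HB Require Import structures.
From mathcomp Require Import all_boot all_order all_algebra.
From mathcomp Require Import all_classical all_reals all_analysis.

Set Implicit Arguments.
Unset Strict Implicit.
Unset Printing Implicit Defensive.

Import Order.TTheory GRing.Theory Num.Theory.

Local Open Scope classical_set_scope.
Local Open Scope ring_scope.

(* Put g z = f (z^+). Each of the inequalities in (R2) bounds one term of a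
   triangle by the two others, so together they amount, up to the constant C,
   to the triangle inequality g (z - x) <= C (g (y - x) + g (z - y)) on H, which
   summed over the coordinates is transitivity of E_f.
   Conversely, if no C works for f v <= C (f u + g (v - u)) with u, v in H, pick
   a pair (u_n, v_n) violating it for C = 2 ^ n.+1 and repeat it about 1 / f v_n
   times: along the resulting sequences 0 E_f u and u E_f v, but not 0 E_f v. *)

Lemma nneseries_cst_pinfty (R : realType) (c : R) :
  0 < c -> (\sum_(0 <= n <oo) c%:E = +oo)%E.
Proof.
move=> c0; apply/eqyP => A A0.
have h : (\sum_(0 <= n < (Num.truncn (A / c)).+1) c%:E <=
          \sum_(0 <= n <oo) c%:E)%E.
  by apply: nneseries_lim_ge => *; rewrite lee_fin ltW.
apply: le_trans h; rewrite sumEFin sumr_const_nat subn0 lee_fin -mulr_natl.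
by rewrite -ler_pdivrMr// ltW// truncnS_gt.
Qed.

(** Enumerate all pairs [(n, j)] by a bijection with [nat]; the pair carries the value [n] when
    [j < k n] and the filler [None] otherwise, so [n] occurs exactly [k n] times. Since [e] is
    chosen before [a], the same [e] can serve two series at once. *)
Lemma exists_sequence_with_multiplicities (R : realType) (k : nat -> nat) :
  exists e : nat -> option nat, forall a : nat -> R, (forall n, 0 <= a n) ->
    (\sum_(0 <= i <oo) (oapp a 0 (e i))%:E = \sum_(0 <= n <oo) (a n *+ k n)%:E)%E.
Proof.
have /card_set_bijP[phi phi_bij] : ([set: nat] #= [set: nat * nat])%card.
  by rewrite card_eq_sym; exact: card_nat2.
exists (fun i => if ((phi i).2 < k (phi i).1)%N then Some (phi i).1 else None).
move=> a a0.
rewrite nneseries_esumT; last by move=> i; case: ifP => _; rewrite lee_fin /=.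
rewrite [RHS]nneseries_esumT; last by move=> n; rewrite lee_fin mulrn_wge0.
pose h (p : nat * nat) : \bar R := (if (p.2 < k p.1)%N then a p.1 else 0)%:E.
transitivity (\esum_(i in [set: nat]) h (phi i)).
  by apply: eq_esum => i _; rewrite /h; case: ifP.
rewrite -(reindex_esum _ _ phi h phi_bij).
have -> : [set: nat * nat] = [set: nat] `*`` (fun=> [set: nat]).
  by apply/seteqP; split.
rewrite -(@esum_esum _ _ _ _ _ (fun i j => h (i, j))) /h /=; last first.
  by move=> i j _ _; case: ifP => _; rewrite lee_fin.
apply: eq_esum => n _.
transitivity (\esum_(j in `I_(k n)) (a n)%:E).
  rewrite [RHS]esum_mkcond; apply: eq_esum => j _.
  by rewrite mem_setE -[j \in _]/(j < k n)%N; case: ifP.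
rewrite esum_fset//; last by move=> *; rewrite lee_fin.
by rewrite -fsbig_ord sumEFin sumr_const card_ord.
Qed.

(* Repeating the n-th pair about 1 / b n times brings the contribution of each
   b n up to at least 1, while that of a n stays below (1 + M) / 2 ^ n.+1. *)
Lemma exists_separating_sequence (R : realType) (a b : nat -> R) (M : R) :
  (forall n, 0 <= a n) -> (forall n, b n <= M) ->
  (forall n, (2 ^ n.+1)%:R * a n < b n) ->
  exists e : nat -> option nat,
    (\sum_(0 <= i <oo) (oapp a 0 (e i))%:E < +oo)%E /\
    (\sum_(0 <= i <oo) (oapp b 0 (e i))%:E = +oo)%E.
Proof.
move=> a0 bM ab.
have b0 n : 0 < b n by apply: le_lt_trans (ab n); rewrite mulr_ge0.
pose k n := (Num.truncn (b n)^-1).+1.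
have [e eE] := exists_sequence_with_multiplicities R k.
exists e; rewrite !eE//; last by move=> n; exact: ltW.
split; last first.
  apply/eqP; rewrite -leye_eq -(nneseries_cst_pinfty (@ltr01 R)).
  apply: lee_nneseries => [*|n _]; rewrite lee_fin// -mulr_natl.
  by rewrite -ler_pdivrMr// div1r ltW// truncnS_gt.
apply: (@le_lt_trans _ _ (1 + M)%:E); last exact: ltry.
(* The series of the bounds [(1 + M) / 2 ^ n.+1] has sum [1 + M]. *)
have half := @cvg_geometric_eseries_half R (1 + M) 0.
rewrite expr0 divr1 in half; rewrite -(cvg_lim _ half)//.
apply: lee_nneseries => [i _ _|n _]; rewrite lee_fin; first exact: mulrn_wge0.
rewrite addn1 ler_pdivlMr ?ltr0n ?expn_gt0// -[_ *+ k n]mulr_natl.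
(* The first [Num.truncn (b n)^-1] copies of [b n] add up to at most 1, the extra one is at most
   [M]. *)
have kb : (k n)%:R * b n <= 1 + M.
  have : (Num.truncn (b n)^-1)%:R <= (b n)^-1 by rewrite truncn_le invr_ge0 ltW.
  rewrite -(ler_pM2r (b0 n)) mulVf ?gt_eqF// => h.
  by rewrite /k -natr1 mulrDl mul1r lerD.
by apply: le_trans kb; rewrite -mulrA ler_wpM2l// mulrC ltW.
Qed.

Section positive_part.
Variables (R : realType) (G : zmodType) (H : set G) (f : G -> R).
Hypothesis H0 : H 0.
Hypothesis Hlin : forall x y : G, H x -> H y -> H (x - y) \/ H (y - x).
Hypothesis Htrans : forall x y z : G, H x -> H y -> H z ->
  H (x - y) -> H (y - z) -> H (x - z).
Hypothesis f_ge0 : nonneg_on H f.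
Hypothesis f_bnd : bounded_on H f.
Hypothesis f_even : even_on H f.

Let g (x : G) : R := f (pos_of H x).

Lemma f_pos_of x : H x -> g x = f x.
Proof. by move=> Hx; rewrite /g /pos_of mem_set. Qed.

(** Evenness matters when both [x] and [- x] lie in [H]: [pos_of] then leaves [- x] unchanged. *)
Lemma f_pos_ofN x : H x -> g (- x) = f x.
Proof.
move=> Hx; rewrite /g /pos_of; case: ifPn; last by rewrite opprK.
by rewrite inE => HNx; rewrite -f_even.
Qed.

Lemma f_pos_of_distC x y : H x -> H y -> g (x - y) = g (y - x).
Proof.
move=> Hx Hy; have [h|h] := Hlin Hx Hy.
  by rewrite -(opprB x y) f_pos_ofN// f_pos_of.
by rewrite -(opprB y x) f_pos_ofN// f_pos_of.
Qed.

Lemma f_pos_of_dist_ge0 x y : H x -> H y -> 0 <= g (x - y).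
Proof.
move=> Hx Hy; have [h|h] := Hlin Hx Hy; first by rewrite f_pos_of// f_ge0.
by rewrite f_pos_of_distC// f_pos_of// f_ge0.
Qed.

Definition quasi_subadditive (C : R) := forall x y : G,
  H x -> H y -> H (x + y) ->
  f (x + y) <= C * (f x + f y) /\ f x <= C * (f (x + y) + f y).

(** Read [H (v - u)] as [u <= v], a total preorder on [H]. For an ordered triple the two short
    differences add up to the long one, so (a) bounds the long distance and (b) either short one. *)
Lemma quasi_triangle C x y z : quasi_subadditive C -> H x -> H y -> H z ->
  g (z - x) <= C * (g (y - x) + g (z - y)).
Proof.
move=> fC Hx Hy Hz.
(* The case [u <= v <= w]; the last inequality is (b) with the two summands exchanged. *)
have dist2 u v w : H u -> H v -> H w -> H (v - u) -> H (w - v) ->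
  [/\ g (w - u) <= C * (g (v - u) + g (w - v)),
      g (v - u) <= C * (g (w - u) + g (w - v)) &
      g (w - v) <= C * (g (w - u) + g (v - u))].
  move=> Hu Hv Hw Hvu Hwv; have Hwu := Htrans Hw Hv Hu Hwv Hvu.
  rewrite !f_pos_of//.
  have := fC (v - u) (w - v) Hvu Hwv; have := fC (w - v) (v - u) Hwv Hvu.
  have -> : (w - v) + (v - u) = w - u by rewrite addrA subrK.
  have -> : (v - u) + (w - v) = w - u by rewrite addrC addrA subrK.
  by move=> /(_ Hwu)[_ ?] /(_ Hwu)[].
(* If [y] lies between [x] and [z], then [g (z - x)] is the long distance; if [y] is on top or at
   the bottom, it is a short one, and [x] and [z] must be compared as well. *)
have [yx|xy] := Hlin Hy Hx; have [zy|yz] := Hlin Hz Hy.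
- by have [] := dist2 _ _ _ Hx Hy Hz yx zy.
- have [zx|xz] := Hlin Hz Hx.
    have [_ + _] := dist2 _ _ _ Hx Hz Hy zx yz.
    by rewrite (f_pos_of_distC Hz Hy).
  have [_ + _] := dist2 _ _ _ Hz Hx Hy xz yx.
  by rewrite (f_pos_of_distC Hz Hx) (f_pos_of_distC Hz Hy) [g (y - x) + _]addrC.
- have [zx|xz] := Hlin Hz Hx.
    have [_ _ +] := dist2 _ _ _ Hy Hx Hz xy zx.
    by rewrite (f_pos_of_distC Hy Hx) [g (x - y) + _]addrC.
  have [_ _ +] := dist2 _ _ _ Hy Hz Hx zy xz.
  by rewrite (f_pos_of_distC Hz Hx) (f_pos_of_distC Hy Hx).
- have [+ _ _] := dist2 _ _ _ Hz Hy Hx yz xy.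
  rewrite (f_pos_of_distC Hz Hx) (f_pos_of_distC Hy Hx) (f_pos_of_distC Hz Hy).
  by rewrite [g (x - y) + _]addrC.
Qed.

Lemma quasi_subadditive_Ef C : f 0 = 0 -> 1 <= C -> quasi_subadditive C ->
  Equivalence (@Ef G R H f).
Proof.
move=> f0 C1 fC; split.
- move=> x; rewrite /Ef eseries0 ?ltry// => n _ _.
  by rewrite subrr -/(g 0) f_pos_of// f0.
- move=> x y; rewrite /Ef; congr (_ < _)%E; apply: eq_eseriesr => n _.
  by congr EFin; apply: f_pos_of_distC; exact: set_valP.
- move=> x y z xy yz; rewrite /Ef.
  apply: (@le_lt_trans _ _ (\sum_(0 <= n <oo) (C%:E *
    ((g (set_val (y n) - set_val (x n)))%:E +
     (g (set_val (z n) - set_val (y n)))%:E)))%E).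
    apply: lee_nneseries => [n _ _|n _]; rewrite -?EFinD -?EFinM lee_fin.
      by apply: f_pos_of_dist_ge0; exact: set_valP.
    by apply: quasi_triangle => //; exact: set_valP.
  have g0 (u v : nat -> set_type H) n :
    (0 <= (g (set_val (u n) - set_val (v n)))%:E)%E.
    by rewrite lee_fin; apply: f_pos_of_dist_ge0; exact: set_valP.
  rewrite nneseriesZl; last by move=> n _; rewrite adde_ge0.
  rewrite nneseriesD//.
  by rewrite lte_mul_pinfty// ?lee_fin ?(le_trans ler01)// lte_add_pinfty.
Qed.

(** Relating the zero sequence to itself makes the constant series of [f 0] converge. *)
Lemma Ef_refl_f0 : Reflexive (@Ef G R H f) -> f 0 = 0.
Proof.
move=> /(_ (fun=> exist _ 0 (mem_set H0))); rewrite /Ef.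
under eq_eseriesr do rewrite subrr -/(g 0) f_pos_of//.
have := f_ge0 H0; rewrite le_eqVlt => /predU1P[//|/nneseries_cst_pinfty ->].
by rewrite ltxx.
Qed.

Lemma Ef_trans_quasi_triangle : f 0 = 0 -> Transitive (@Ef G R H f) ->
  exists2 C : R, 1 <= C & forall u v, H u -> H v -> f v <= C * (f u + g (v - u)).
Proof.
move=> f0 Etrans; apply: contrapT => noC.
have counterex n : exists p : set_type H * set_type H,
    (2 ^ n.+1)%:R * (f (set_val p.1) + g (set_val p.2 - set_val p.1))
      < f (set_val p.2).
  apply: contrapT => none; apply: noC; exists (2 ^ n.+1)%:R.
    by rewrite ler1n expn_gt0.
  move=> u v Hu Hv; rewrite leNgt; apply/negP => uv; apply: none.
  by exists (exist _ u (mem_set Hu), exist _ v (mem_set Hv)).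
have [p p_gt] := choice counterex.
have Hp1 n : H (set_val (p n).1) by exact: set_valP.
have Hp2 n : H (set_val (p n).2) by exact: set_valP.
have [M fM] := f_bnd.
have d0 n : 0 <= g (set_val (p n).2 - set_val (p n).1) by exact: f_pos_of_dist_ge0.
(* Taking the sum of both distances as the small series lets [small] dominate the series of [f u]
   and that of [g (v - u)] alike. *)
have [|n|n|e [small big]] := @exists_separating_sequence R
  (fun n => f (set_val (p n).1) + g (set_val (p n).2 - set_val (p n).1))
  (fun n => f (set_val (p n).2)) M _ _ _; [|exact: fM|exact: p_gt|].
  by move=> n; rewrite addr_ge0// f_ge0.
(* Filler positions get 0 in both [u] and [v]; they contribute nothing because [f 0 = 0]. *)
pose zero : set_type H := exist _ 0 (mem_set H0).
pose u i := oapp (fun n => (p n).1) zero (e i).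
pose v i := oapp (fun n => (p n).2) zero (e i).
have gzero (x : set_type H) : g (set_val x - set_val zero) = f (set_val x).
  by rewrite subr0 f_pos_of//; exact: set_valP.
have : Ef f (fun=> zero) v.
  apply: (Etrans _ u).
    apply: le_lt_trans small; apply: lee_nneseries => [i _ _|i _];
      rewrite lee_fin -/(g _) gzero.
      by apply: f_ge0; exact: set_valP.
    by rewrite /u; case: (e i) => [n|] /=; rewrite ?f0// lerDl.
  apply: le_lt_trans small; apply: lee_nneseries => [i _ _|i _];
    rewrite lee_fin -/(g _).
    by apply: f_pos_of_dist_ge0; exact: set_valP.
  rewrite /u /v; case: (e i) => [n|] /=; first by rewrite lerDr f_ge0.
  by rewrite subrr f_pos_of// f0.
rewrite /Ef; under eq_eseriesr do rewrite -/(g _) gzero.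
suff E i : f (set_val (v i)) = oapp (fun n => f (set_val (p n).2)) 0 (e i).
  by under eq_eseriesr do rewrite E; rewrite big ltxx.
by rewrite /v; case: (e i).
Qed.

End positive_part.

Theorem proposition2 (R : realType) (G : zmodType) (H : set G)
    (H0 : H 0)
    (Hlin : forall x y : G, H x -> H y -> H (x - y) \/ H (y - x))
    (Htrans : forall x y z : G, H x -> H y -> H z ->
       H (x - y) -> H (y - z) -> H (x - z))
    (f : G -> R)
    (f_ge0 : nonneg_on H f) (f_bnd : bounded_on H f) (f_even : even_on H f) :
  Equivalence (@Ef G R H f) <->
  (f 0 = 0 /\
   exists C : R, 1 <= C /\
     forall x y : G, H x -> H y -> H (x + y) ->
       f (x + y) <= C * (f x + f y) /\ f x <= C * (f (x + y) + f y)).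
Proof.
split=> [[Erefl _ Etrans]|[f0 [C [C1 fC]]]]; last first.
  by apply: quasi_subadditive_Ef C1 fC.
have f0 := Ef_refl_f0 H0 f_ge0 Erefl; split=> //.
have [C C1 fC] := Ef_trans_quasi_triangle H0 Hlin f_ge0 f_bnd f_even f0 Etrans.
(* For (a) take the pair [x], [x + y], with difference [y]; for (b) reverse it, with difference
   [- y]. *)
exists C; split=> // x y Hx Hy Hxy; split.
  by have := fC x (x + y) Hx Hxy; rewrite addrAC subrr add0r f_pos_of.
have := fC (x + y) x Hxy Hx.
by rewrite opprD addrA subrr sub0r f_pos_ofN.
Qed.
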